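(* Let $\Omega$, $F$, $K$, $e$ be as in the context. Then the following relationships hold: (i) $\bigcup_{p \in \mathbb{N}} \operatorname{wargmin}_x(\mathcal{VP}_p) \subseteq \operatorname{wargmin}(\mathcal{SP}) = \bigcap_{\varepsilon >0}\bigcup_{p\in \mathbb{N}} \varepsilon\text{-}\operatorname{wargmin}_x(\mathcal{VP}_p)$; (ii) $\bigcup_{p \in \mathbb{N}} \operatorname{argmin}_x(\mathcal{VP}_p) \subseteq \operatorname{argmin}^{II}(\mathcal{SP}) \subseteq \bigcap_{\varepsilon >0}\bigcup_{p\in \mathbb{N}} \varepsilon\text{-}\operatorname{argmin}_x(\mathcal{VP}_p)$.
   Context: $\mathbb{N}=\{1,2,\ldots\}$ and $[p]=\{1,\ldots,p\}$. Setting: $\Omega\subseteq\mathbb{R}^n$ is nonempty and closed; $F:\mathbb{R}^n\rightrightarrows\mathbb{R}^m$ is a set-valued mapping with $\Omega\subseteq \operatorname{dom}F:=\{x: F(x)\neq\emptyset\}$ and $F(x)$ compact for every $x\in\Omega$; $K\subseteq\mathbb{R}^m$ is a closed, convex, pointed ($K\cap(-K)=\{0\}$), solid ($\operatorname{int}K\ne\emptyset$) cone; $e\in\operatorname{int}K$ is fixed. Set optimization problem $(\mathcal{SP})$: minimize $F(x)$ over $x\in\Omega$ with respect to the lower set less relation. For $\varepsilon\ge 0$, a point $\bar x\in\Omega$ is an $\varepsilon$-weakly minimal solution of $(\mathcal{SP})$ if there is no $x\in\Omega$ with $F(\bar x)-\varepsilon e\subseteq F(x)+\operatorname{int}K$;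 it is a type-two $\varepsilon$-minimal solution if there is no $x\in\Omega$ with $F(\bar x)-\varepsilon e\subseteq F(x)+K\setminus\{0\}$. For $\varepsilon=0$ the sets of these solutions are denoted $\operatorname{wargmin}(\mathcal{SP})$ and $\operatorname{argmin}^{II}(\mathcal{SP})$, respectively. Multiobjective problem $(\mathcal{VP}_p)$, $p\in\mathbb{N}$: minimize $(y^1,\ldots,y^p)\in\mathbb{R}^{mp}$ with respect to the cone $K^p=\prod_{i=1}^pK$ over all feasible $(x,y^1,\ldots,y^p)$, i.e. $x\in\Omega$ and $y^i\in F(x)$ for all $i\in[p]$. For $\varepsilon\ge0$, a feasible $(\bar x,\bar y^1,\ldots,\bar y^p)$ is an $\varepsilon$-weakly minimal solution if there is no feasible $(x,y^1,\ldots,y^p)$ with $\bar y^i-\varepsilon e-y^i\in\operatorname{int}K$ for all $i\in[p]$; it is an $\varepsilon$-minimal solution if there is no feasible $(x,y^1,\ldots,y^p)$ with $(\bar y^1-\varepsilon e-y^1,\ldots,\bar y^p-\varepsilon e-y^p)\in K^p\setminus\{0\}$. The sets $\varepsilon\text{-}\operatorname{wargmin}_x(\mathcal{VP}_p)$ and $\varepsilon\text{-}\operatorname{argmin}_x(\mathcal{VP}_p)$ are the projections onto the $x$-component in $\mathbb{R}^n$ of the sets of $\varepsilon$-weakly minimal and $\varepsilon$-minimal solutions of $(\mathcal{VP}_p)$, respectively; the prefix $\varepsilon$- is dropped when $\varepsilon=0$. *)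

(* Defs.v *)
From mathcomp Require Import all_boot all_order all_algebra.
From mathcomp Require Import all_classical all_reals all_analysis.
Set Implicit Arguments.
Unset Strict Implicit.
Unset Printing Implicit Defensive.
Import Order.TTheory GRing.Theory Num.Theory.
Import numFieldNormedType.Exports.

Local Open Scope classical_set_scope.
Local Open Scope ring_scope.

Section cones.
Context {R : realType} {m : nat}.
Implicit Types A B K : set 'rV[R]_m.

Definition set_add A B : set 'rV[R]_m := [set a + b | a in A & b in B].

Definition set_translate A (v : 'rV[R]_m) : set 'rV[R]_m :=
  [set a + v | a in A].

Definition is_cone K : Prop :=
  K !=set0 /\ forall (t : R) (v : 'rV[R]_m), 0 <= t -> K v -> K (t *: v).

Definition pointed_cone K : Prop := K `&` [set - v | v in K] = [set 0].

Definition solid K : Prop := K° !=set0.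

Definition ordering_cone K : Prop :=
  [/\ is_cone K, closed K, convex_set K, pointed_cone K & solid K].

(* The cone K^p in R^(mp) = (R^m)^p, a point of which is a family indexed by
   'I_p. *)
Definition cone_power (p : nat) K : set ('I_p -> 'rV[R]_m) :=
  [set v | forall i, K (v i)].

End cones.

Section problems.
Context {R : realType} {n m : nat}.
Variables (Omega : set 'rV[R]_n) (F : 'rV[R]_n -> set 'rV[R]_m).
Variables (K : set 'rV[R]_m) (e : 'rV[R]_m).

Definition dom : set 'rV[R]_n := [set x | F x !=set0].

Definition SP_weakly_minimal (eps : R) (xb : 'rV[R]_n) : Prop :=
  Omega xb /\
  ~ exists2 x, Omega x &
      set_translate (F xb) (- (eps *: e)) `<=` set_add (F x) K°.

Definition SP_type2_minimal (eps : R) (xb : 'rV[R]_n) : Prop :=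
  Omega xb /\
  ~ exists2 x, Omega x &
      set_translate (F xb) (- (eps *: e)) `<=` set_add (F x) (K `\ 0).

Definition SP_wargmin : set 'rV[R]_n := [set x | SP_weakly_minimal 0 x].

Definition SP_argminII : set 'rV[R]_n := [set x | SP_type2_minimal 0 x].

Definition VP_feasible (p : nat) (x : 'rV[R]_n) (y : 'I_p -> 'rV[R]_m) : Prop :=
  Omega x /\ forall i, F x (y i).

Definition VP_weakly_minimal (p : nat) (eps : R)
    (xb : 'rV[R]_n) (yb : 'I_p -> 'rV[R]_m) : Prop :=
  VP_feasible xb yb /\
  ~ exists (x : 'rV[R]_n) (y : 'I_p -> 'rV[R]_m),
      VP_feasible x y /\ forall i, K° (yb i - eps *: e - y i).

Definition VP_minimal (p : nat) (eps : R)
    (xb : 'rV[R]_n) (yb : 'I_p -> 'rV[R]_m) : Prop :=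
  VP_feasible xb yb /\
  ~ exists (x : 'rV[R]_n) (y : 'I_p -> 'rV[R]_m),
      VP_feasible x y /\
      (cone_power K `\ (fun=> 0)) (fun i : 'I_p => yb i - eps *: e - y i).

Definition VP_wargmin_x (eps : R) (p : nat) : set 'rV[R]_n :=
  [set x | exists y : 'I_p -> 'rV[R]_m, VP_weakly_minimal eps x y].

Definition VP_argmin_x (eps : R) (p : nat) : set 'rV[R]_n :=
  [set x | exists y : 'I_p -> 'rV[R]_m, VP_minimal eps x y].

End problems.

(* Main.v *)
(* A compact set F(x) admits a finite (eps e - int K)-net y^1, ..., y^p: every
   a in F(x) lies in y^i - eps e + int K for some i.  If (y^1 - eps e, ...,
   y^p - eps e) were dominated by (z^1, ..., z^p) in F(x')^p, then K + int K
   being contained in int K would give F(x) in F(x') + int K; so x, when minimal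
   for (SP), is the first component of an eps-minimal solution of (VP_p).
   Conversely, by compactness of F(x), an inclusion of F(x) in F(x') + int K
   survives a translation by - eps e for all small eps > 0, which contradicts
   eps-weak minimality. *)
Require Import Defs.
From mathcomp Require Import all_boot all_order all_algebra.
From mathcomp Require Import finmap.
From mathcomp Require Import all_classical all_reals all_analysis.
Import Order.TTheory GRing.Theory Num.Theory.
Import numFieldNormedType.Exports.

Local Open Scope classical_set_scope.
Local Open Scope ring_scope.

Set Implicit Arguments.
Unset Strict Implicit.

Section interiors.
Context {R : realType} {V : normedModType R}.
Implicit Types (A : set V) (u v : V).

(** The map [w - u] is continuous and sends [u + v] to [v], so it pulls [A] back to a neighbourhood
    of [u + v], and stability under adding [u] puts this neighbourhood inside [A]. *)
Lemma interior_translate A u v :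
  (forall w, A w -> A (u + w)) -> A° v -> A° (u + v).
Proof.
move=> Au Av.
have /(_ A) : (fun w : V => w - u) w @[w --> u + v] --> v.
  rewrite -[X in _ --> X](addrK u v) (addrC v).
  exact: (cvgB cvg_id (cvg_cst _)).
move/(_ Av) => near_A.
apply: (@filterS _ (nbhs (u + v)) _ ((fun w => w - u) @^-1` A)) near_A => w /Au.
by rewrite addrC subrK.
Qed.

Lemma interior_scale A (t : R) v :
  0 < t -> (forall w, A w -> A (t *: w)) -> A° v -> A° (t *: v).
Proof.
move=> t0 At Av.
have /(_ A) : (fun w : V => t^-1 *: w) w @[w --> t *: v] --> v.
  rewrite -[X in _ --> X](scalerK (lt0r_neq0 t0) v).
  exact: scaler_continuous.
move/(_ Av) => near_A.
apply: (@filterS _ (nbhs (t *: v)) _ (( *:%R t^-1) @^-1` A)) near_A => w /At.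
by rewrite scalerKV ?lt0r_neq0.
Qed.

Lemma compact_finite_net A (U : set V) :
  compact A -> A !=set0 -> open U -> U 0 ->
  exists (p : nat) (y : 'I_p -> V), [/\ (0 < p)%N, (forall i, A (y i)) &
    forall a, A a -> exists i, U (a - y i)].
Proof.
rewrite compact_cover => cA [a0 Aa0] oU U0.
have [||D DA AD] := cA V A (fun y => [set a | U (a - y)]).
- move=> y _; apply: (@open_comp _ _ (fun a : V => a - y) U) => // a _.
  exact: (cvgB cvg_id (cvg_cst _)).
- by move=> a Aa; exists a => //=; rewrite subrr.
(* The net enumerates the finite subcover by translates of [U]; the default [0] is never reached,
   since [i] is below [size D]. *)
exists (size D), (fun i => nth 0 D i); split.
- by have [y /= yD _] := AD _ Aa0; rewrite -has_predT; apply/hasP; exists y.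
- by move=> i; apply/set_mem/DA; rewrite mem_nth.
- move=> a /AD[y /= yD Uay]; have := yD; rewrite -index_mem => iD.
  by exists (Ordinal iD); rewrite /= nth_index.
Qed.

End interiors.

Section ordering_cones.
Context {R : realType} {m : nat} (K : set 'rV[R]_m).
Hypothesis hK : ordering_cone K.
Implicit Types (A B : set 'rV[R]_m) (u v w e : 'rV[R]_m).

Lemma ordering_coneZ (t : R) v : 0 <= t -> K v -> K (t *: v).
Proof. by case: hK => -[_ KZ] *; exact: KZ. Qed.

(** The sum is twice the midpoint, which lies in [K] by convexity. *)
Lemma ordering_coneD u v : K u -> K v -> K (u + v).
Proof.
case: hK => _ _ Kconv _ _ Ku Kv.
have half_ge0 : 0 <= 2^-1 :> R by [].
have half_le1 : 2^-1 <= 1 :> R by rewrite invf_le1 ?ler1n.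
have := Kconv u v (Itv01 half_ge0 half_le1).
rewrite !inE => /(_ Ku Kv) /(ordering_coneZ (ler0n R 2)).
rewrite /conv /= scalerDr !scalerA.
have -> : unstable.onem 2^-1 = 2^-1 :> R.
  by rewrite /unstable.onem [X in X - _](splitr 1) mul1r addrK.
by rewrite mulfV ?pnatr_eq0// !scale1r.
Qed.

Lemma ordering_cone_pointed v : K v -> K (- v) -> v = 0.
Proof.
case: hK => _ _ _ Kpt _ Kv KNv.
have : (K `&` [set - w | w in K]) v by split=> //; exists (- v); rewrite ?opprK.
by rewrite Kpt.
Qed.

Lemma interior_coneD u v : K u -> K° v -> K° (u + v).
Proof. by move=> Ku; apply: interior_translate => w; exact: ordering_coneD. Qed.

Lemma interior_coneZ (t : R) v : 0 < t -> K° v -> K° (t *: v).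
Proof.
by move=> t0; apply: interior_scale => // w; apply: ordering_coneZ; exact: ltW.
Qed.

(** A neighbourhood of 0 absorbs every vector: [t *: w] is in [K] for small [t > 0], and rescaling
    gives [w] in [K]. So [K] is the whole space, and pointedness makes that space trivial. *)
Lemma interior_cone0 v : K° 0 -> v = 0.
Proof.
move=> K0.
have KT w : K w.
  have /(_ K K0) : t *: w @[t --> (0 : R)^'+] --> (0 : 'rV[R]_m).
    rewrite -(scale0r w); apply: cvg_at_right_filter.
    exact: scalel_continuous.
  move=> near_K.
  near (0 : R)^'+ => t.
  have t0 : 0 < t by [].
  have Ktw : K (t *: w) by near: t.
  rewrite -(scalerK (lt0r_neq0 t0) w); apply: ordering_coneZ => //.
  by rewrite invr_ge0 ltW.
exact: ordering_cone_pointed.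
Unshelve. all: by end_near. Qed.

Lemma compact_cone_net A e (eps : R) :
  K° e -> 0 < eps -> compact A -> A !=set0 ->
  exists (p : nat) (y : 'I_p -> 'rV[R]_m), [/\ (0 < p)%N,
    (forall i, A (y i)) & forall a, A a -> exists i, K° (a - (y i - eps *: e))].
Proof.
move=> Ke eps0 cA A0.
(* The open set is the interior of [K] shifted by [- eps *: e]; it contains 0 because [eps *: e] is
   interior to [K]. *)
have [||p [y [p0 Ay yA]]] := @compact_finite_net _ _ A
    [set v | K° (v + eps *: e)] cA A0.
- apply: (@open_comp _ _ (fun v => v + eps *: e) K°).
    by move=> v _; exact: (cvgD cvg_id (cvg_cst _)).
  exact: open_interior.
- by rewrite /= add0r; exact: interior_coneZ.
exists p, y; split=> // a /yA[i /= Kai].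
by exists i; rewrite opprB addrA addrAC.
Qed.

(** A tube argument: that [a - t *: e] lies in [set_add B K°] holds for all pairs near each [(a, 0)]
    with [a] in [A], and compactness makes the range of [t] uniform in [a]. *)
Lemma near_set_translate_interior A B e :
  compact A -> A `<=` set_add B K° ->
  \forall t \near (0 : R), set_translate A (- (t *: e)) `<=` set_add B K°.
Proof.
move=> /compact_near_coveringP cA AB.
have near0 : \forall t \near (0 : R),
    A `<=` (fun a => set_add B K° (a - t *: e)).
  apply: (cA R (nbhs (0 : R)) (fun t a => set_add B K° (a - t *: e))).
  move=> a /AB[b Bb [k Kk <-{a}]].
  (* The point [b] of [B] stays fixed; only the interior summand moves with the pair. *)
  have shift : p.1 - p.2 *: e - b @[p --> (b + k, 0 : R)] --> k.
    have -> : nbhs k = nbhs (b + k - 0 *: e - b).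
      by rewrite scale0r subr0 addrAC subrr add0r.
    apply: cvgB; last exact: cvg_cst.
    apply: cvgB; first exact: cvg_fst.
    by apply: cvgZr_tmp; exact: cvg_snd.
  have near_shift : \forall p \near (b + k, 0 : R), K° (p.1 - p.2 *: e - b) :=
    shift _ (open_nbhs_nbhs (conj (@open_interior _ K) Kk)).
  apply: filterS near_shift => -[a t] /= Kat.
  by exists b => //; exists (a - t *: e - b) => //; rewrite addrC subrK.
by apply: filterS near0 => t At _ [a Aa <-]; exact: At.
Qed.

Lemma set_translate_scale0 A e : set_translate A (- (0 *: e)) = A.
Proof.
rewrite scale0r oppr0; apply/seteqP; split=> [_ [a Aa <-]|a Aa].
  by rewrite addr0.
by exists a; rewrite ?addr0.
Qed.

(** Keeping [C] arbitrary lets one selection serve both [K°] and [K] without 0. *)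
Lemma set_add_selection A B C (p : nat) (y : 'I_p -> 'rV[R]_m) e :
  set_translate A e `<=` set_add B C -> (forall i, A (y i)) ->
  exists z : 'I_p -> 'rV[R]_m,
    (forall i, B (z i)) /\ (forall i, C (y i + e - z i)).
Proof.
move=> AB Ay.
have /choice[z Bz] : forall i, exists z, B z /\ C (y i + e - z).
  move=> i; have [|z Bz [c Cc <-]] := AB (y i + e); first by exists (y i).
  by exists z; rewrite addrAC subrr add0r.
by exists z; split=> i; case: (Bz i).
Qed.

(** Write [a - z i] as [(a - y i) + (y i - z i)], an interior vector plus a vector of [K]. Asking
    only for [K] in the last hypothesis covers weak and strict domination alike. *)
Lemma cone_net_sub A B (p : nat) (y z : 'I_p -> 'rV[R]_m) :
  (forall a, A a -> exists i, K° (a - y i)) ->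
  (forall i, B (z i)) -> (forall i, K (y i - z i)) -> A `<=` set_add B K°.
Proof.
move=> yA Bz Kyz a /yA[i Kai]; exists (z i) => //.
exists (a - z i); last by rewrite addrC subrK.
by rewrite -(subrKA (y i)) addrC; exact: interior_coneD.
Qed.

End ordering_cones.

Section problems.
Context {R : realType} {n m : nat}.
Variables (Omega : set 'rV[R]_n) (F : 'rV[R]_n -> set 'rV[R]_m).
Variables (K : set 'rV[R]_m) (e : 'rV[R]_m).

Lemma VP_wargmin_x_sub (eps : R) (p : nat) (x : 'rV[R]_n) :
  VP_wargmin_x Omega F K e eps p x -> SP_weakly_minimal Omega F K e eps x.
Proof.
move=> [y [[Ox Fy] min_y]]; split=> // -[x' Ox' Fxx'].
have [y' [Fy' Kyy']] := set_add_selection Fxx' Fy.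
by apply: min_y; exists x', y'.
Qed.

Lemma VP_argmin_x_sub (eps : R) (p : nat) (x : 'rV[R]_n) : (0 < p)%N ->
  VP_argmin_x Omega F K e eps p x -> SP_type2_minimal Omega F K e eps x.
Proof.
move=> p0 [y [[Ox Fy] min_y]]; split=> // -[x' Ox' Fxx'].
have [y' [Fy' Kyy']] := set_add_selection Fxx' Fy.
apply: min_y; exists x', y'; split=> //.
(* Since [p] is positive there is a coordinate, and its difference is nonzero; hence so is the whole
   family. *)
split=> [i|/(congr1 (@^~ (Ordinal p0)))].
  by have [] := Kyy' i.
by have [] := Kyy' (Ordinal p0).
Qed.

End problems.

Theorem theorem3p5 (R : realType) (n m : nat)
    (Omega : set 'rV[R]_n) (F : 'rV[R]_n -> set 'rV[R]_m)
    (K : set 'rV[R]_m) (e : 'rV[R]_m)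
    (hOmega0 : Omega !=set0) (hOmega : closed Omega)
    (hdom : Omega `<=` dom F)
    (hF : forall x, Omega x -> compact (F x))
    (hK : ordering_cone K) (he : K° e) :
  (\bigcup_(p in [set p : nat | (0 < p)%N]) VP_wargmin_x Omega F K e 0 p
     `<=` SP_wargmin Omega F K e /\
   SP_wargmin Omega F K e =
     \bigcap_(eps in [set eps : R | 0 < eps])
       \bigcup_(p in [set p : nat | (0 < p)%N]) VP_wargmin_x Omega F K e eps p)
  /\
  (\bigcup_(p in [set p : nat | (0 < p)%N]) VP_argmin_x Omega F K e 0 p
     `<=` SP_argminII Omega F K e /\
   SP_argminII Omega F K e `<=`
     \bigcap_(eps in [set eps : R | 0 < eps])
       \bigcup_(p in [set p : nat | (0 < p)%N]) VP_argmin_x Omega F K e eps p).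
Proof.
have net eps x : 0 < eps -> Omega x -> exists (p : nat) (y : 'I_p -> 'rV[R]_m),
    [/\ (0 < p)%N, VP_feasible Omega F x y &
        forall x' y', VP_feasible Omega F x' y' ->
        (forall i, K (y i - eps *: e - y' i)) -> F x `<=` set_add (F x') K°].
  move=> eps0 Ox.
  have [p [y [p0 Fy ynet]]] :=
    compact_cone_net hK he eps0 (hF _ Ox) (hdom _ Ox).
  exists p, y; split=> // x' y' [_ Fy']; exact: cone_net_sub.
split; split.
- by move=> x [p _ /VP_wargmin_x_sub].
- apply/seteqP; split=> [x [Ox min_x] eps /= eps0|x min_x].
    have [p [y [p0 fy ynet]]] := net _ _ eps0 Ox.
    exists p => //; exists y; split=> // -[x' [y' [fy' Kyy']]].
    apply: min_x; exists x'; first by case: fy'.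
    rewrite set_translate_scale0; apply: (ynet _ _ fy') => i.
    exact: interior_subset.
  (* Any positive tolerance gives feasibility of [x]; 1 is taken. *)
  have Ox : Omega x by have [p _ [y [[]]]] := min_x _ ltr01.
  split=> // -[x' Ox']; rewrite set_translate_scale0 => FxFx'.
  have near_sub := near_set_translate_interior e (hF _ Ox) FxFx'.
  (* Pick [eps > 0] so small that the inclusion survives the shift by [- eps *: e]; this refutes the
     [eps]-weak minimality that [min_x] yields. *)
  near (0 : R)^'+ => eps.
  have eps0 : 0 < eps by [].
  have [p _ /VP_wargmin_x_sub[_]] := min_x eps eps0.
  by apply; exists x' => //; near: eps; exact: cvg_within.
- by move=> x [p p0 /(VP_argmin_x_sub p0)].
- move=> x [Ox min_x] eps /= eps0.
  have [p [y [p0 fy ynet]]] := net _ _ eps0 Ox.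
  exists p => //; exists y; split=> // -[x' [y' [fy' [Kyy' yy'_neq0]]]].
  apply: min_x; exists x'; first by case: fy'.
  rewrite set_translate_scale0 => a /(ynet _ _ fy' Kyy')[b Fb [k Kk <-]].
  exists b => //; exists k => //; split; first exact: interior_subset.
  (* 0 is an interior point of K only in the degenerate case m = 0. *)
  move=> k0; apply: yy'_neq0; apply/funext => i.
  by apply: (interior_cone0 hK); rewrite -k0.
Unshelve. all: by end_near. Qed.
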